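(* For every $\varepsilon>0$ and every integer $p\ge 2$, any (possibly randomized) $p$-player protocol for Max-Card-$k$ (in the $p$-player model described in the context) with an approximation guarantee of $$\frac{p+(H_p)^2}{2p-H_p}\cdot(1+\varepsilon)$$ must have communication complexity $\Omega\!\left(\frac{N\varepsilon}{p^3}\right)$, where $N=|W|$. Furthermore, this holds even in the special case in which the objective function $f$ is a (weighted) coverage function and $k=p$.
   Context: $H_p=1+\frac12+\cdots+\frac1p$ is the $p$-th harmonic number. The $p$-player model for Max-Card-$k$: the global information known to all players is a positive integer $k$, a finite ground set $W$ and a partition of $W$ into disjoint sets $W_1,\dots,W_p$. Player $i\in[p]$ privately receives a set $V_i\subseteq W_i$ and a value oracle for a non-negative monotone submodular function $f:2^W\to\mathbb{R}_{\ge0}$ that can evaluate $f$ on every subset of $W_1\cup\cdots\cup W_i$. A protocol consists of $p$ possibly randomized algorithms: player 1 computes a message $m_1$ from the global information and its private information; for $i=2,\dots,p-1$, player $i$ computes $m_i$ from the global information, its private information and $m_{i-1}$; player $p$ computes from the global information, its private information and $m_{p-1}$ an output $S\subseteq V_1\cup\cdots\cup V_p$ with $|S|\le k$. The communication complexity is the maximum length in bits of any of $m_1,\dots,m_{p-1}$ over all inputs and randomness. The approximation guarantee is $\rho$ if for every instance $\mathbb{E}[f(S)]\ge\rho\cdot\max\{f(T):T\subseteq V_1\cup\cdots\cup V_p,\ |T|\le k\}$. A weighted coverage function is $f(S)=\sum_{u\in\bigcup_{v\in S}v} a(u)$ where each element of $W$ is a subset of a finite universe $U$ with weights $a:U\to\mathbb{R}_{\ge0}$.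 The constant in $\Omega$ is absolute. *)

(* Defs.v *)
From Stdlib Require Import Rdefinitions.
From HB Require Import structures.
From mathcomp Require Import all_boot all_order all_algebra.
From mathcomp Require Import Rstruct.
Set Implicit Arguments. Unset Strict Implicit. Unset Printing Implicit Defensive.
Import Order.TTheory GRing.Theory Num.Theory.
Local Open Scope ring_scope.

Definition harmonic (p : nat) : R := \sum_(i < p) ((i.+1)%:R)^-1.

Definition msg (L : nat) : finType := {n : 'I_L.+1 & n.-tuple bool}.

(* A (finitely supported) probability distribution on a finite type:
   the law of the output of a randomized algorithm on a fixed input. *)
Record dist (T : finType) := Dist {
  pmf :> {ffun T -> R};
  pmf_ge0 : forall x, 0 <= pmf x;
  pmf_sum1 : \sum_x pmf x = 1 }.

(* A p-player protocol on ground set W with messages of at most L bits.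
   Global info: k : nat and the partition part : W -> 'I_p (W_i = part^-1 i).
   Player i's private info: V_i and oracle access to f on subsets of
   W_1 u ... u W_i, given as the function S |-> f (S :&: (W_1 u..u W_i))
   (see [oracle]).  Randomness is private; a randomized algorithm is
   represented by the distribution of its output on each input. *)
Record protocol (W : finType) (p L : nat) := Protocol {
  first_player : nat -> (W -> 'I_p) -> {set W} -> ({set W} -> R) -> dist (msg L);
  (* player i (0-based index i, used for 1 <= i <= p-2) *)
  middle_player : nat -> nat -> (W -> 'I_p) -> {set W} -> ({set W} -> R) ->
                  msg L -> dist (msg L);
  last_player : nat -> (W -> 'I_p) -> {set W} -> ({set W} -> R) ->
                msg L -> dist {set W} }.

(* W_1 u ... u W_(i+1) for the 0-based player index i *)
Definition prefix (W : finType) (p : nat) (part : W -> 'I_p) (i : nat) : {set W} :=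
  [set w | (nat_of_ord (part w) <= i)%N].

Definition oracle (W : finType) (p : nat) (part : W -> 'I_p) (f : {set W} -> R)
  (i : nat) : {set W} -> R := fun S => f (S :&: prefix part i).

(* law of the message sent by (0-based) player i, for i <= p-2 *)
Fixpoint msg_law (W : finType) (p L : nat) (P : protocol W p L) (k : nat)
  (part : W -> 'I_p) (V : nat -> {set W}) (f : {set W} -> R) (i : nat)
  : {ffun msg L -> R} :=
  match i with
  | 0 => pmf (first_player P k part (V 0%N) (oracle part f 0))
  | i'.+1 => [ffun m' => \sum_(m : msg L)
       msg_law P k part V f i' m *
       middle_player P i'.+1 k part (V i'.+1) (oracle part f i'.+1) m m']
  end.

Definition out_law (W : finType) (p L : nat) (P : protocol W p L) (k : nat)
  (part : W -> 'I_p) (V : nat -> {set W}) (f : {set W} -> R) : {ffun {set W} -> R} :=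
  [ffun S => \sum_(m : msg L) msg_law P k part V f (p - 2) m *
       last_player P k part (V (p - 1)%N) (oracle part f (p - 1)) m S].

(* V_i subset of W_i for every player i < p (and V_i empty for i >= p) *)
Definition valid_private (W : finType) (p : nat) (part : W -> 'I_p)
  (V : nat -> {set W}) : Prop :=
  forall i : nat, V i \subset [set w | (part w == i :> nat)].

Definition union_V (W : finType) (p : nat) (V : nat -> {set W}) : {set W} :=
  \bigcup_(i < p) V i.

Definition weighted_coverage (W : finType) (f : {set W} -> R) : Prop :=
  exists (n : nat) (elt : W -> {set 'I_n}) (a : 'I_n -> R),
    injective elt /\ (forall u, 0 <= a u) /\
    forall S : {set W}, f S = \sum_(u in \bigcup_(v in S) elt v) a u.

Definition guarantee_on_coverage_k_eq_p (W : finType) (p L : nat)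
  (P : protocol W p L) (rho : R) : Prop :=
  forall (part : W -> 'I_p) (V : nat -> {set W}) (f : {set W} -> R),
    valid_private part V -> weighted_coverage f ->
    let k := p in
    (forall S, 0 < out_law P k part V f S ->
        S \subset union_V p V /\ (#|S| <= k)%N) /\
    (forall T : {set W}, T \subset union_V p V -> (#|T| <= k)%N ->
        rho * f T <= \sum_S out_law P k part V f S * f S).

Definition approx_threshold (p : nat) (eps : R) : R :=
  (p%:R + harmonic p ^+ 2) / (2 * p%:R - harmonic p) * (1 + eps).

(* Main.v *)
(* The hard function is f(S) = P(S meets X) for a random set X built class by class:
   as long as the process is alive it puts every element of W_j into X independently
   with probability 1 - decay j, and it dies as soon as X contains the special element
   o_j of W_j; the last class always kills it.  Hence {o_0, ..., o_(p-1)} has value 1,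
   while on W_0 u ... u W_i the element o_i looks like any other element of W_i.
   Let surv j be the probability of being alive before class j.  A set with one
   ordinary element per class misses X with probability about the integral of s ds over
   [0, 1], that is 1/2; since the probability of missing is convex in the numbers of
   elements taken per class, surv j = sqrt ((p - j) / p), which equalizes its partial
   derivatives, makes this choice nearly optimal among all sets of size p.

   A protocol beating the threshold must therefore output some o_i, i < p - 1, with
   probability at least eps / 2.  As the output is always feasible, o_i must lie in every
   V_i compatible with the message of player i, who does not know o_i.  For a uniform
   V_i and L-bit messages there are at most about L such certain elements on average,
   so eps / 2 is at most about p * L / |W_i|. *)

Require Import Defs.
From Stdlib Require Import Rdefinitions FunctionalExtensionality.
From HB Require Import structures.
From mathcomp Require Import all_boot all_order all_algebra.
From mathcomp Require Import Rstruct reals exp lra ring zify.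
Set Implicit Arguments. Unset Strict Implicit. Unset Printing Implicit Defensive.
Import Order.TTheory GRing.Theory Num.Theory.
Local Open Scope ring_scope.

(** * Harmonic sums and the survival probabilities *)

Section Numerics.
Variable R : realType.
Implicit Types (m n p i j : nat).

Definition hsum n : R := \sum_(i < n) i.+1%:R^-1.

Lemma hsumS n : hsum n.+1 = hsum n + n.+1%:R^-1.
Proof. by rewrite /hsum big_ord_recr. Qed.

Lemma hsum_ge0 n : 0 <= hsum n.
Proof. by apply: sumr_ge0 => i _; rewrite invr_ge0 ler0n. Qed.

Lemma hsum_ge32 n : (1 < n)%N -> 3 / 2 <= hsum n.
Proof.
case: n => [|[|n]] // _; elim: n => [|n IHn].
  rewrite /hsum !big_ord_recr big_ord0 /=; lra.
by rewrite hsumS (le_trans IHn) // lerDl invr_ge0 ler0n.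
Qed.

(** Each [1/m] with [m <= n] lies in the gaps of the [m - 1] indices with [i.+1 < m], and so
    contributes [1 - 1/m]. *)
Lemma sum_hsum_gap n :
  \sum_(i < n) (hsum n - hsum i.+1) = n%:R - hsum n.
Proof.
elim: n => [|n IHn]; first by rewrite big_ord0 /hsum big_ord0 subrr.
rewrite big_ord_recr /= subrr addr0 [in LHS]hsumS.
under eq_bigr => i _ do rewrite addrAC.
rewrite big_split /= IHn sumr_const card_ord hsumS.
rewrite -[n.+1%:R^-1 *+ n]mulr_natl.
have n0 : n.+1%:R != 0 :> R by rewrite pnatr_eq0.
by rewrite -natr1 in n0 *; field.
Qed.

Lemma ln_succ_le n : (0 < n)%N -> ln (n.+1%:R : R) <= ln n%:R + n%:R^-1.
Proof.
move=> n0; have n0R : 0 < n%:R :> R by rewrite ltr0n.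
have -> : n.+1%:R = n%:R * (1 + n%:R^-1) :> R.
  by rewrite mulrDr mulr1 divff ?natr1 // gt_eqF.
have i0 : 0 < n%:R^-1 :> R by rewrite invr_gt0.
rewrite lnM ?posrE ?addr_gt0 // lerD2l le_ln1Dx //; lra.
Qed.

Lemma ln_succ_ge n : (0 < n)%N -> ln n%:R + n.+1%:R^-1 <= ln (n.+1%:R : R).
Proof.
move=> n0; have n0R : 0 < n%:R :> R by rewrite ltr0n.
have S0 : 0 < n.+1%:R :> R by rewrite ltr0n.
have -> : n%:R = n.+1%:R * (1 - n.+1%:R^-1) :> R.
  by rewrite mulrBr mulr1 divff ?gt_eqF // -natr1 addrK.
have i1 : n.+1%:R^-1 < 1 :> R by rewrite invf_lt1 // ltr1n.
rewrite lnM ?posrE ?subr_gt0 //.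
have : ln (1 + (- n.+1%:R^-1)) <= - n.+1%:R^-1 :> R by apply: le_ln1Dx; rewrite ltrN2.
by rewrite -addrA gerDl -lerBrDr sub0r.
Qed.

Lemma hsum_gap_le_ln m n : (0 < m)%N -> (m <= n)%N ->
  hsum n - hsum m <= ln n%:R - ln m%:R.
Proof.
move=> m0; elim: n => [|n IHn]; first by rewrite leqn0 => /eqP mn; rewrite mn in m0.
rewrite leq_eqVlt => /predU1P[->|mn]; first by rewrite !subrr.
have /(lerD (IHn mn)) := ln_succ_ge (leq_trans m0 mn).
by rewrite hsumS; set a := ln n.+1%:R; set c := n.+1%:R^-1; lra.
Qed.

Lemma ln_le_hsum n : ln n%:R <= hsum n.
Proof.
case: n => [|n]; first by rewrite ln0 // hsum_ge0.
suff : ln n.+1%:R <= hsum n :> R.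
  by move/le_trans; apply; rewrite hsumS lerDl invr_ge0 ler0n.
elim: n => [|n IHn]; first by rewrite ln1 hsum_ge0.
by rewrite (le_trans (@ln_succ_le n.+1 isT)) // hsumS lerD2r.
Qed.

(** * Survival probabilities and their estimates *)

Definition surv p j : R := Num.sqrt ((p - j)%:R / p%:R).
Definition weight p j : R := surv p j - surv p j.+1.
(** The conditional probability of surviving class [j]; it is 0 for the last class, since
    [surv p p = 0]. *)
Definition decay p j : R := surv p j.+1 / surv p j.

Lemma surv_ge0 p j : 0 <= surv p j. Proof. exact: sqrtr_ge0. Qed.

Lemma surv_sqr p j : surv p j ^+ 2 = (p - j)%:R / p%:R.
Proof. by rewrite sqr_sqrtr // divr_ge0 ?ler0n. Qed.

Lemma surv_gt0 p j : (j < p)%N -> 0 < surv p j.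
Proof.
by move=> jp; rewrite sqrtr_gt0 divr_gt0 ?ltr0n ?subn_gt0 // (leq_ltn_trans _ jp).
Qed.

Lemma surv0 p : (0 < p)%N -> surv p 0 = 1.
Proof. by move=> p0; rewrite /surv subn0 divff ?sqrtr1 // pnatr_eq0 -lt0n. Qed.

Lemma surv_end p : surv p p = 0.
Proof. by rewrite /surv subnn mul0r sqrtr0. Qed.

Lemma surv_decr p j : surv p j.+1 <= surv p j.
Proof.
apply: ler_wsqrtr; apply: ler_wpM2r; first by rewrite invr_ge0 ler0n.
by rewrite ler_nat leq_sub2l.
Qed.

Lemma weight_ge0 p j : 0 <= weight p j.
Proof. by rewrite subr_ge0 surv_decr. Qed.

Lemma decay_ge0 p j : 0 <= decay p j.
Proof. by rewrite divr_ge0 ?surv_ge0. Qed.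

Lemma decay_le1 p j : decay p j <= 1.
Proof.
have := surv_ge0 p j; rewrite le_eqVlt => /predU1P[j0|j0].
  by rewrite /decay -j0 invr0 mulr0 ler01.
by rewrite ler_pdivrMr // mul1r surv_decr.
Qed.

Lemma surv_decay p j : (j < p)%N -> surv p j * decay p j = surv p j.+1.
Proof. by move=> jp; rewrite mulrC divfK // gt_eqF // surv_gt0. Qed.

Lemma sum_weight p i : (i <= p)%N -> \sum_(i <= j < p) weight p j = surv p i.
Proof.
move=> ip; have := telescope_sumr (surv p) ip.
rewrite surv_end sub0r => /(congr1 -%R); rewrite opprK -sumrN => <-.
by apply: eq_bigr => j _; rewrite opprB.
Qed.

(** For [a = surv p j] and [b = surv p j.+1], the product [(a - b) b] is [(a^2 - b^2) / 2] minus
    [(a - b)^2 / 2]; here [a^2 - b^2 = 1/p], and the square is of lower order. *)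
Lemma weight_surv_ge p j : (j.+1 < p)%N ->
  (1 - (4 * (p - j.+1)%:R)^-1) / (2 * p%:R) <= weight p j * surv p j.+1.
Proof.
move=> jp; have p0 : 0 < p%:R :> R by rewrite ltr0n (leq_trans _ jp).
have m0 : 0 < (p - j.+1)%:R :> R by rewrite ltr0n subn_gt0.
have := surv_sqr p j; have := surv_sqr p j.+1.
have -> : (p - j)%:R = (p - j.+1)%:R + 1 :> R by rewrite natr1 subnSK // ltnW.
have := surv_decr p j; have := surv_gt0 jp; rewrite /weight.
move: (surv p j) (surv p j.+1) (p - j.+1)%:R p%:R m0 p0 => a b m p' m0 p0 b0 ab b2 a2.
have a2' : a ^+ 2 = b ^+ 2 + p'^-1 by rewrite a2 b2 mulrDl mul1r.
have pE : p'^-1 = b ^+ 2 / m by rewrite b2; field; rewrite !gt_eqF.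
(* Since [a^2 = b^2 (1 + 1/m)], this is [sqrt (1 + x) <= 1 + x/2] at [x = 1/m]. *)
have aub : a - b <= b / (2 * m).
  rewrite lerBlDl -ler_sqr ?nnegrE; last 2 first.
  - by rewrite (le_trans _ ab) ?ltW.
  - by rewrite addr_ge0 ?divr_ge0 ?mulr_ge0 ?ltW.
  have : 0 <= (b / (2 * m)) ^+ 2 by exact: sqr_ge0.
  rewrite a2' pE; set c := b / (2 * m); have -> : b ^+ 2 / m = 2 * b * c
    by rewrite /c; field; rewrite gt_eqF.
  nra.
have ab2 : (a - b) ^+ 2 <= (a - b) * (b / (2 * m)).
  by rewrite expr2 ler_wpM2l ?subr_ge0.
have ab3 : (a - b) * (b / (2 * m)) <= (a ^+ 2 - b ^+ 2) / (4 * m).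
  have -> : (a ^+ 2 - b ^+ 2) / (4 * m) = (a - b) * (((a + b) / 2) / (2 * m)).
    by field; rewrite gt_eqF.
  have m0' : 0 <= (2 * m)^-1 by rewrite invr_ge0 mulr_ge0 ?ltW.
  by rewrite ler_wpM2l ?subr_ge0 // ler_wpM2r //; lra.
have -> : (1 - (4 * m)^-1) / (2 * p') = (p'^-1 - p'^-1 / (4 * m)) / 2.
  by field; rewrite !gt_eqF.
have a2d : p'^-1 = a ^+ 2 - b ^+ 2 by rewrite a2' addrC addKr.
rewrite a2d; nra.
Qed.

Lemma weight_surv_le p j : weight p j * surv p j.+1 <= (surv p j ^+ 2 - surv p j.+1 ^+ 2) / 2.
Proof.
have := sqr_ge0 (surv p j - surv p j.+1).
by rewrite /weight; move: (surv p j) (surv p j.+1) => a b; nra.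
Qed.

Lemma decay_gt0 p j : (j.+1 < p)%N -> 0 < decay p j.
Proof. by move=> jp; rewrite divr_gt0 ?surv_gt0 // ltnW. Qed.

Lemma ln_surv p j : (j < p)%N -> ln (surv p j) = (ln (p - j)%:R - ln p%:R) / 2.
Proof.
move=> jp; have p0 : (0 < p)%N by apply: leq_ltn_trans jp.
rewrite -ln_div ?posrE ?ltr0n ?subn_gt0 // -surv_sqr lnXn ?surv_gt0 //.
by rewrite mulr2n; field.
Qed.

Lemma ln_decay_ge p i : (i.+1 < p)%N -> - (2 * (p - i.+1)%:R)^-1 <= ln (decay p i).
Proof.
move=> ip; have ip' := ltnW ip.
rewrite ln_div ?posrE ?surv_gt0 // !ln_surv //.
have m0 : (0 < p - i.+1)%N by rewrite subn_gt0.
have := ln_succ_le m0; rewrite subnSK // invfM.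
by set a := ln _; set b := ln _; set c := ln _; set d := _%:R^-1; lra.
Qed.

Lemma sum_weight_surv_le p i : (i.+1 < p)%N ->
  \sum_(i <= j < p.-1) weight p j * surv p j.+1 <= (p - i.+1)%:R / (2 * p%:R).
Proof.
case: p => [|q] // iq /=; rewrite ltnS in iq.
apply: (@le_trans _ _ (\sum_(i <= j < q)
   ((- surv q.+1 j.+1 ^+ 2 / 2) - (- surv q.+1 j ^+ 2 / 2)))).
  by apply: ler_sum => j _; have := weight_surv_le q.+1 j; lra.
rewrite (telescope_sumr (fun j => - surv q.+1 j ^+ 2 / 2)) 1?ltnW // !surv_sqr.
rewrite subSnn subSS -natr1.
have -> : (q.+1 - i)%:R = (q - i)%:R + 1 :> R by rewrite natr1 subSn // ltnW.
by rewrite le_eqVlt; apply/orP; left; apply/eqP; field; rewrite nat1r pnatr_eq0.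
Qed.

(** The factor [p - i.+1] of [sum_weight_surv_le] cancels the one in [ln_decay_ge], so the bound is
    the same for every class: here the square root equalizes the partial derivatives. *)
Lemma ln_decay_sum_ge p i : (0 < p)%N ->
  - (4 * p%:R)^-1 <= (\sum_(i <= j < p.-1) weight p j * surv p j.+1) * ln (decay p i).
Proof.
move=> p0; have p0R : 0 < p%:R :> R by rewrite ltr0n.
case: (ltnP i.+1 p) => ip; last first.
  rewrite big_geq; last by rewrite -ltnS prednK.
  by rewrite mul0r oppr_le0 invr_ge0 mulr_ge0 // ltW.
have m0 : 0 < (p - i.+1)%:R :> R by rewrite ltr0n subn_gt0.
set G := \sum_(_ <= _ < _) _; have G0 : 0 <= G.
  by apply: sumr_ge0 => j _; rewrite mulr_ge0 ?weight_ge0 ?surv_ge0.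
have -> : - (4 * p%:R)^-1 = (p - i.+1)%:R / (2 * p%:R) * - (2 * (p - i.+1)%:R)^-1 :> R.
  by field; rewrite !gt_eqF.
apply: le_trans (ler_wpM2l G0 (ln_decay_ge ip)).
by rewrite !mulrN lerN2 ler_wpM2r ?sum_weight_surv_le // invr_ge0 mulr_ge0 // ltW.
Qed.

(** * The miss probability of a set of at most [p] elements *)

Definition slack p : R := (1 / 2 + 3 / 8 * hsum p + hsum p ^+ 2 / 16) / p%:R.

(** A discrete form of the integral of [s (1 - ln s)] over [0, 1], which is [1/2 + 1/4], with
    [weight p j] as step length; [slack] collects the errors. *)
Lemma sum_weight_surv_ln_ge p : (1 < p)%N ->
  3 / 4 - slack p <= \sum_(j < p.-1) weight p j * surv p j.+1 * (1 - ln (surv p j.+1)).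
Proof.
case: p => [|[|q]] // _; set p := q.+2 => /=.
have p0 : 0 < p%:R :> R by rewrite ltr0n.
have H0 := hsum_ge0 p.
(* Term [k] stands for the class [j] with [p - j.+1 = k.+1]. There [ln p - ln k.+1] is replaced by
   its lower bound [hsum p - hsum k.+1] in the main term and by its upper bound [hsum p] in the
   error term. *)
apply: (@le_trans _ _ (\sum_(k < q.+1) (2 * p%:R)^-1 *
   (1 + (hsum p - hsum k.+1) / 2 - (1 / 4 + hsum p / 8) * k.+1%:R^-1))).
  rewrite -mulr_sumr big_split /= big_split /= sumrN -mulr_sumr.
  rewrite -[\sum_(i < q.+1) _^-1]/(hsum q.+1) sumr_const card_ord.
  rewrite -mulr_suml.
  have := sum_hsum_gap p; rewrite big_ord_recr /= subrr addr0 => ->.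
  have Hq : hsum q.+1 <= hsum p by rewrite [hsum p]hsumS lerDl invr_ge0 ler0n.
  have -> : 1 *+ q.+1 = p%:R - 1 :> R by rewrite /p -[q.+2%:R]natr1 addrK.
  have -> : 3 / 4 - slack p = (2 * p%:R)^-1 * 
     (p%:R - 1 + (p%:R - hsum p) / 2 - (1 / 4 + hsum p / 8) * hsum p).
    by rewrite /slack; field; rewrite gt_eqF.
  rewrite ler_wpM2l //; first by rewrite invr_ge0 mulr_ge0 ?ltW.
  rewrite lerD2l lerN2 ler_wpM2l //.
  by rewrite addr_ge0 ?divr_ge0.
rewrite [leLHS](reindex_inj rev_ord_inj) /=; apply: ler_sum => j _.
have jq := ltn_ord j; rewrite ltnS in jq.
have kE : (q.+1 - j.+1).+1 = (p - j.+1)%N by rewrite /p subSS subSS subSn.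
rewrite kE; have jp : (j.+1 < p)%N by rewrite ltnS ltn_ord.
have m0 : (0 < p - j.+1)%N by rewrite subn_gt0.
have := weight_surv_ge jp.
rewrite ln_surv //.
have gapl := hsum_gap_le_ln m0 (leq_subr j.+1 p).
have gapu : ln p%:R - ln (p - j.+1)%:R <= hsum p.
  by rewrite (le_trans _ (ln_le_hsum p)) // gerBl ln_ge0 // ler1n.
have gap0 : 0 <= ln p%:R - ln (p - j.+1)%:R :> R.
  by rewrite subr_ge0 ler_ln ?posrE ?ltr0n // ler_nat leq_subr.
have x0 : 0 <= (p - j.+1)%:R^-1 :> R by rewrite invr_ge0.
have c0 : 0 <= (2 * p%:R)^-1 :> R by rewrite invr_ge0 mulr_ge0 ?ltW.
rewrite invfM mulrC; move: gapl gapu gap0 x0 c0.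
rewrite -(opprB (ln p%:R)).
set l := ln _ - ln _; set x := _%:R^-1; set g := hsum p - _; set c := (2 * _)^-1.
move=> gl lH l0 x0 c0 wge.
have l1 : 0 <= 1 - - l / 2 by lra.
apply: le_trans (ler_wpM2r l1 wge); rewrite -mulrA ler_wpM2l //.
have : x * l <= x * hsum p by rewrite ler_wpM2l.
by nra.
Qed.

(* Tangent of the exponential at the configuration with one element per class. *)
Lemma prod_decay_ge p j (W : finType) (cls : W -> nat) (S : {set W}) : (j.+1 < p)%N ->
  surv p j.+1 * (1 - ln (surv p j.+1) + \sum_(v in S | (cls v <= j)%N) ln (decay p (cls v)))
  <= \prod_(v in S | (cls v <= j)%N) decay p (cls v).
Proof.
move=> jp; have s0 := surv_gt0 jp.
set l := \sum_(v in S | _) _.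
have -> : \prod_(v in S | (cls v <= j)%N) decay p (cls v) = sequences.expR l.
  rewrite expR_sum; apply: eq_bigr => v /andP[_ vj].
  by rewrite lnK // posrE decay_gt0 // (leq_ltn_trans _ jp).
have -> : sequences.expR l = surv p j.+1 * sequences.expR (l - ln (surv p j.+1)).
  by rewrite expRB lnK ?posrE // mulrC divfK // gt_eqF.
rewrite ler_pM2l // (le_trans _ (expR_ge1Dx _)) //; lra.
Qed.

(** Summing the tangents of [prod_decay_ge] over the classes before the last gives the constant
    [3/4 - slack], and each of the at most [p] elements lowers it by at most [1/(4p)], whatever its
    class. *)
Lemma miss_mass_ge p (W : finType) (cls : W -> nat) (S : {set W}) :
  (1 < p)%N -> (#|S| <= p)%N ->
  1 / 2 - slack p <=
  \sum_(j < p.-1) weight p j * \prod_(v in S | (cls v <= j)%N) decay p (cls v).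
Proof.
move=> p1 Sp; have p0 := ltnW p1; have p0R : 0 < p%:R :> R by rewrite ltr0n.
apply: (@le_trans _ _ (\sum_(j < p.-1) (weight p j * surv p j.+1 * (1 - ln (surv p j.+1)) +
  \sum_(v in S | (cls v <= j)%N) weight p j * surv p j.+1 * ln (decay p (cls v))))).
  rewrite big_split /=.
  suff : - (1 / 4) <= \sum_(j < p.-1) \sum_(v in S | (cls v <= j)%N)
      weight p j * surv p j.+1 * ln (decay p (cls v)).
    have := sum_weight_surv_ln_ge p1.
    by set a := \sum_(_ < _) _; set b := \sum_(_ < _) _; set c := slack p; lra.
  under eq_bigr => j _ do rewrite big_mkcondr.
  rewrite exchange_big /=.
  apply: (@le_trans _ _ (\sum_(v in S) - (4 * p%:R)^-1)).
    rewrite sumr_const mulNrn lerN2 -[_^-1 *+ _]mulr_natl ler_pdivrMr ?mulr_gt0 //.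
    by have -> : 1 / 4 * (4 * p%:R) = p%:R :> R by [field]; rewrite ler_nat.
  apply: ler_sum => v _; have := ln_decay_sum_ge (cls v) p0.
  rewrite mulr_suml; congr (_ <= _).
  by rewrite big_geq_mkord -big_mkcond.
apply: ler_sum => j _; rewrite -mulr_sumr -mulrDr -mulrA.
rewrite ler_wpM2l ?weight_ge0 //.
by apply: prod_decay_ge; rewrite -ltn_predRL.
Qed.

(** * Comparison with the threshold *)

Definition threshold p : R := (p%:R + hsum p ^+ 2) / (2 * p%:R - hsum p).

Lemma threshold_ge p : (1 < p)%N -> 1 / 2 + slack p <= threshold p.
Proof.
move=> p1; have H := hsum_ge32 p1.
have p0 : 0 < p%:R :> R by rewrite ltr0n ltnW.
have Hp : hsum p <= p%:R.
  rewrite -subr_ge0 -sum_hsum_gap sumr_ge0 // => i _; rewrite subr_ge0.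
  elim: p {H p0 p1} i => [|n IHn] i; first by case: i.
  have [->|ni] := eqVneq (i : nat) n; first by [].
  have iltn : (i < n)%N by rewrite ltn_neqAle ni -ltnS ltn_ord.
  by rewrite (le_trans (IHn (Ordinal iltn))) // [leRHS]hsumS lerDl invr_ge0.
rewrite /threshold ler_pdivlMr; last by lra.
rewrite /slack; set h := hsum p in H Hp *; set n := p%:R in p0 Hp *.
have -> : 1 / 2 + (1 / 2 + 3 / 8 * h + h ^+ 2 / 16) / n =
    (n / 2 + 1 / 2 + 3 / 8 * h + h ^+ 2 / 16) / n.
  by field; rewrite gt_eqF.
rewrite mulrAC ler_pdivrMr //.
(* After clearing denominators and dropping a term of favourable sign, [1 + h/4 + h^2/8 <= h^2]
   remains; [h >= 3/2] suffices, which is where [p >= 2] enters. *)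
have hn : n * (1 + h / 4) <= n * (7 / 8 * h ^+ 2) by rewrite ler_pM2l //; nra.
have h3 : 0 <= h * (1 / 2 + 3 / 8 * h + h ^+ 2 / 16).
  by rewrite mulr_ge0 ?addr_ge0 ?divr_ge0 ?mulr_ge0 ?sqr_ge0 //; lra.
lra.
Qed.

Lemma threshold_ge12 p : (1 < p)%N -> 1 / 2 <= threshold p.
Proof.
move=> p1; rewrite (le_trans _ (threshold_ge p1)) // lerDl.
have H0 := hsum_ge0 p; have H2 := sqr_ge0 (hsum p).
by apply: divr_ge0 => //; lra.
Qed.

End Numerics.

(** * Weighted coverage functions from random sets *)

(** Read [1 - m v] as the probability that a random set [B] contains [v]: this is the probability
    that [B] misses [S]. Replacing [1 - m v] by 0 on [S] removes the sets that meet [S], and the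
    full sum factors. *)
Lemma sum_disjoint_prod (A : comNzRingType) (W : finType) (m : W -> A) (S : {set W}) :
  \sum_(B : {set W} | [disjoint S & B]) \prod_v (if v \in B then 1 - m v else m v)
  = \prod_(v in S) m v.
Proof.
pose F v := if v \in S then 0 else 1 - m v.
transitivity (\sum_(B : {set W}) \prod_v (if v \in B then F v else m v)).
  rewrite big_mkcond; apply: eq_bigr => B _; case: ifPn => [dSB|].
    apply: eq_bigr => v _; case: ifP => // vB; rewrite /F.
    by rewrite (disjointFl dSB vB).
  rewrite -setI_eq0 => /set0Pn[v]; rewrite inE => /andP[vS vB].
  by rewrite (bigD1 v) //= vB /F vS mul0r.
rewrite -bigA_distr [RHS]big_mkcond; apply: eq_bigr => v _.
by rewrite /F; case: ifP => _ /=; rewrite ?add0r ?subrK.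
Qed.

(* Universe: pairs (j, B), covered by v iff v \in B, weighted by w j times the
   probability of B when v is drawn with probability 1 - m j v independently. *)
Lemma weighted_coverage_mixture (W : finType) (J : nat) (w : 'I_J.+1 -> R)
    (m : 'I_J.+1 -> W -> R) :
  (forall j, 0 <= w j) -> (forall j v, 0 <= m j v <= 1) ->
  weighted_coverage (fun S : {set W} => \sum_j w j * (1 - \prod_(v in S) m j v)).
Proof.
move=> w0 m01; pose U : finType := ('I_J.+1 * {set W})%type.
pose c (x : U) := w x.1 * \prod_v (if v \in x.2 then 1 - m x.1 v else m x.1 v).
pose pt (u : 'I_#|U|) : U := enum_val u.
exists #|U|, (fun v => [set u | v \in (pt u).2]), (fun u => c (pt u)).
split; [|split].
(* The point [(ord0, [set v])] of the universe is covered by [v] alone, whence injectivity. *)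
- move=> v v' /setP/(_ (enum_rank ((ord0, [set v]) : U))).
  by rewrite !inE /pt enum_rankK /= !inE eqxx => /esym/eqP.
- move=> u; rewrite /c mulr_ge0 // prodr_ge0 // => v _.
  by case: ifP => _; case/andP: (m01 (pt u).1 v); rewrite ?subr_ge0.
move=> S; transitivity (\sum_(x : U | ~~ [disjoint S & x.2]) c x); last first.
  rewrite (reindex pt) /=; last exact/onW_bij/enum_val_bij.
  apply: eq_bigl => u; rewrite -setI_eq0; apply/set0Pn/bigcupP.
    by case=> v; rewrite inE => /andP[vS vu]; exists v => //; rewrite inE.
  by case=> v vS; rewrite inE => vu; exists v; rewrite inE vS.
rewrite (eq_bigl (fun x : U => xpredT x.1 && ~~ [disjoint S & x.2])) //.
rewrite -(pair_big_dep xpredT (fun (_ : 'I_J.+1) (B : {set W}) => ~~ [disjoint S & B])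
  (fun j B => c (j, B))) /=.
apply: eq_bigr => j _; rewrite /c /= -mulr_sumr; congr (_ * _).
rewrite -(sum_disjoint_prod (m j) S).
have T1 : \sum_(B : {set W}) \prod_v (if v \in B then 1 - m j v else m j v) = 1 :> R.
  have := sum_disjoint_prod (m j) set0; rewrite big_set0 => E; rewrite -[RHS]E.
  by apply: eq_bigl => B; rewrite -setI_eq0 set0I eqxx.
by rewrite -[X in X - _]T1 (bigID (fun B : {set W} => [disjoint S & B])) /= addrC addrK.
Qed.

(** * The chain function *)

Section Chain.
Variables (R : realType) (W : finType) (p : nat) (part : W -> 'I_p).
Implicit Types (o : nat -> W) (i j k : nat) (S : {set W}).

(* The probability that v is not in the random set, given that it dies in class j. *)
Definition miss o j v : R :=
  if v == o j then 0
  else if (part v <= j)%N && (v != o (part v)) then decay R p (part v) else 1.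

Definition chain o S : R :=
  \sum_(j < p) weight R p j * (1 - \prod_(v in S) miss o j v).

Definition class_section o := forall k, (k < p)%N -> part (o k) = k :> nat.

Lemma miss_itv o j v : 0 <= miss o j v <= 1.
Proof.
rewrite /miss; case: ifP => _; last case: ifP => _; rewrite ?lexx ?ler01 //.
by rewrite decay_ge0 decay_le1.
Qed.

Lemma prod_miss_itv o j S : 0 <= \prod_(v in S) miss o j v <= 1.
Proof.
have m0 v : 0 <= miss o j v by case/andP: (miss_itv o j v).
rewrite prodr_ge0 //= prodr_ile1 // => v _; exact: miss_itv.
Qed.

Lemma chainE o S : (0 < p)%N ->
  chain o S = 1 - \sum_(j < p) weight R p j * \prod_(v in S) miss o j v.
Proof.
move=> p0; rewrite -[X in X - _](surv0 R p0) -sum_weight // big_mkord -sumrB.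
by apply: eq_bigr => j _; rewrite mulrBr mulr1.
Qed.

Lemma chain_le1 o S : (0 < p)%N -> chain o S <= 1.
Proof.
move=> p0; rewrite chainE // gerBl sumr_ge0 // => j _.
by rewrite mulr_ge0 ?weight_ge0 //; case/andP: (prod_miss_itv o j S).
Qed.

Lemma chain_full o S : (0 < p)%N -> (forall k, (k < p)%N -> o k \in S) -> chain o S = 1.
Proof.
move=> p0 oS; rewrite chainE // big1 ?subr0 // => j _.
by rewrite (bigD1 (o j)) ?oS //= /miss eqxx mul0r mulr0.
Qed.

(** Without special elements of classes before the last, every factor [miss o j v] with [j < p.-1]
    is that of an ordinary element, so [miss_mass_ge] applies. The term of the last class is
    discarded, so [S] may contain its special element. *)
Lemma chain_avoid_le o S : (1 < p)%N -> (#|S| <= p)%N ->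
  (forall k, (k < p.-1)%N -> o k \notin S) -> chain o S <= 1 / 2 + slack R p.
Proof.
move=> p1 Sp oS; have p0 := ltnW p1; rewrite chainE //.
suff : 1 / 2 - slack R p <= \sum_(j < p) weight R p j * \prod_(v in S) miss o j v by lra.
apply: le_trans (miss_mass_ge R (fun v => part v) p1 Sp) _.
rewrite -(big_mkord xpredT (fun j =>
  weight R p j * \prod_(v in S | (part v <= j)%N) decay R p (part v))).
rewrite -(big_mkord xpredT (fun j => weight R p j * \prod_(v in S) miss o j v)).
rewrite [leRHS](@big_cat_nat _ _ _ p.-1) ?leq_pred //= ler_wpDr //.
  apply: sumr_ge0 => j _.
  by rewrite mulr_ge0 ?weight_ge0 //; case/andP: (prod_miss_itv o j S).
rewrite le_eqVlt; apply/orP; left; apply/eqP.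
apply: eq_big_nat => j /andP[_ jp]; congr (_ * _).
rewrite big_mkcondr; apply: eq_bigr => v vS; rewrite /miss.
have -> : (v == o j) = false.
  by apply/negP => /eqP vo; have := oS j jp; rewrite -vo vS.
case: leqP => //= vj; case: eqP => //= vo.
by have := oS _ (leq_ltn_trans vj jp); rewrite -vo vS.
Qed.

(* On W_0 u ... u W_i the element o i is not distinguished from the rest of its class. *)
Lemma chain_prefix o i S : class_section o -> (i < p)%N -> S \subset Defs.prefix part i ->
  chain o S = \sum_(j < i) weight R p j * (1 - \prod_(v in S) miss o j v) +
    surv R p i * (1 - \prod_(v in S)
      (if (part v < i)%N && (v == o (part v)) then 1 else decay R p (part v))).
Proof.
move=> ot ip Si; have Sle v : v \in S -> (part v <= i)%N.
  by move=> /(subsetP Si); rewrite inE.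
rewrite /chain -!(big_mkord xpredT (fun j => weight R p j * (1 - \prod_(v in S) miss o j v))).
rewrite (@big_cat_nat _ _ _ i) //=; last exact: ltnW.
congr (_ + _); rewrite big_ltn //.
pose A := \prod_(v in S) (if v == o (part v) then 1 else decay R p (part v)).
have Aj j : (i < j < p)%N -> \prod_(v in S) miss o j v = A.
  case/andP=> ij jp; apply: eq_bigr => v vS; rewrite /miss.
  have vj : (part v < j)%N by rewrite (leq_ltn_trans _ ij) ?Sle.
  have -> : (v == o j) = false.
    by apply/negP => /eqP vo; move: vj; rewrite vo ot // ltnn.
  by rewrite (ltnW vj) /=; case: eqP.
rewrite (@eq_big_nat _ _ _ i.+1 p _ (fun j => weight R p j * (1 - A))); last first.
  by move=> j jp; rewrite Aj.
rewrite -mulr_suml sum_weight //.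
(* If [o i \in S], the classes from [i] on contribute [weight p i + surv p i.+1 * (1 - A)], which is
   [surv p i * (1 - decay p i * A)]: [o i] acts like an ordinary element. *)
have [oS|oS] := boolP (o i \in S).
  rewrite [\prod_(v in S) miss _ _ _](bigD1 (o i)) //= /miss eqxx mul0r subr0 mulr1.
  suff -> : \prod_(v in S) (if (part v < i)%N && (v == o (part v)) then 1
     else decay R p (part v)) = decay R p i * A.
    by rewrite [in RHS]mulrBr mulrA surv_decay // /weight; ring.
  rewrite (bigD1 (o i)) //= ot // ltnn /A [in RHS](bigD1 (o i)) //= ot // eqxx mul1r.
  congr (_ * _); apply: eq_bigr => v /andP[vS voi].
  have [pvi|vi] := eqVneq (part v : nat) i.
    by rewrite pvi ltnn /= (negPf voi).
  by rewrite ltn_neqAle vi Sle.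
have -> : \prod_(v in S) miss o i v = A.
  apply: eq_bigr => v vS; rewrite /miss.
  have -> : (v == o i) = false by apply/negP => /eqP vo; rewrite -vo vS in oS.
  by rewrite Sle //=; case: eqP.
suff -> : \prod_(v in S) (if (part v < i)%N && (v == o (part v)) then 1
     else decay R p (part v)) = A.
  by rewrite -mulrDl /weight subrK.
apply: eq_bigr => v vS.
have [pvi|vi] := eqVneq (part v : nat) i.
  rewrite pvi ltnn /=; case: eqP => // vo.
  by rewrite -vo vS in oS.
by rewrite ltn_neqAle vi Sle.
Qed.

(** The formula of [chain_prefix] involves only special elements of classes before [i], so the
    oracle of player [i] reveals nothing about [o i]. *)
Lemma chain_local o o' i S : class_section o -> class_section o' -> (i < p)%N ->
  (forall k, (k < i)%N -> o k = o' k) ->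
  chain o (S :&: Defs.prefix part i) = chain o' (S :&: Defs.prefix part i).
Proof.
move=> ot ot' ip oo'; rewrite !(@chain_prefix _ i) ?subsetIr //.
have Sle v : v \in S :&: Defs.prefix part i -> (part v <= i)%N.
  by rewrite !inE => /andP[].
congr (_ + _).
  apply: eq_bigr => j _; congr (_ * (1 - _)); apply: eq_bigr => v _.
  rewrite /miss oo' //; case: ifP => // _; case: leqP => //= vj.
  by rewrite oo' // (leq_ltn_trans vj).
congr (_ * (1 - _)); apply: eq_bigr => v _.
by case: ltnP => //= vi; rewrite oo'.
Qed.

End Chain.

Lemma chain_coverage (W : finType) (p : nat) (part : W -> 'I_p) (o : nat -> W) :
  (0 < p)%N -> weighted_coverage (chain R part o).
Proof.
case: p part => // p part _.
apply: (@weighted_coverage_mixture W p (fun j => weight R p.+1 j) (fun j => miss R part o j)).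
  by move=> j; rewrite weight_ge0.
by move=> j v; apply: miss_itv.
Qed.

(** * Elements certified by a short message *)

Section Counting.
Variables (R : realFieldType) (n K : nat) (M : finType) (a : {set 'I_n} -> M -> R).
Hypotheses (a0 : forall V m, 0 <= a V m) (a1 : forall V, \sum_m a V m = 1).
Hypothesis cardM : (#|M| <= 2 ^ K)%N.

(** The elements of every set on which [m] can be sent; after [m], an always feasible output can use
    no others. *)
Definition certain (m : M) : {set 'I_n} := [set x | [forall V, (0 < a V m) ==> (x \in V)]].

(** An excess of [c] over [k] is at most [2^(c - k)]; the factor [2^c] is later offset by the
    fraction [2^-c] of sets that contain [c] given elements. *)
Lemma natr_le_add_exp (c k : nat) : c%:R <= k%:R + 2 ^+ c / 2 ^+ k :> R.
Proof.
have [ck|kc] := leqP c k.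
  by rewrite (le_trans (_ : _ <= k%:R)) ?ler_nat // lerDl divr_ge0 ?exprn_ge0.
rewrite -(subnKC (ltnW kc)) natrD exprD mulrC mulKf ?expf_neq0 ?pnatr_eq0 //.
  by rewrite lerD2l -natrX ler_nat ltnW // ltn_expl.
Qed.

Lemma a_le1 V m : a V m <= 1.
Proof. by rewrite -(a1 V) (bigD1 m) //= lerDl sumr_ge0. Qed.

Lemma card_supersets (C : {set 'I_n}) : #|[set V : {set 'I_n} | C \subset V]| = (2 ^ (n - #|C|))%N.
Proof.
have -> : [set V : {set 'I_n} | C \subset V] = (@setC _) @: powerset (~: C).
  apply/setP => V; rewrite inE; apply/idP/imsetP => [CV|[U]].
    by exists (~: V); rewrite ?setCK // inE setCS.
  by rewrite inE => UC ->; rewrite -setCS setCK.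
rewrite card_imset; last exact: (can_inj (@setCK _)).
by rewrite card_powerset cardsCs setCK card_ord.
Qed.

(** A message with certain set [C] is sent only on the [2^(n - #|C|)] sets containing [C], so the
    exponential excess costs [2^(n - K)] per message, and [2^n] over at most [2^K] messages. *)
Lemma certain_mass_le :
  \sum_V \sum_m a V m * #|certain m|%:R <= 2 ^+ n * K.+1%:R.
Proof.
rewrite exchange_big /=.
apply: (@le_trans _ _ (\sum_m ((\sum_V a V m) * K%:R + 2 ^+ n / 2 ^+ K))).
  apply: ler_sum => m _; set C := certain m.
  apply: (@le_trans _ _ (\sum_V (a V m * K%:R +
      (if C \subset V then 2 ^+ #|C| / 2 ^+ K else 0)))).
    apply: ler_sum => V _; have := a0 V m; rewrite le_eqVlt => /predU1P[<-|aV].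
      by rewrite !mul0r add0r; case: ifP => // _; rewrite divr_ge0 ?exprn_ge0.
    have -> : C \subset V.
      by apply/subsetP => x; rewrite inE => /forallP/(_ V)/implyP/(_ aV).
    rewrite (le_trans (ler_wpM2l (a0 V m) (natr_le_add_exp #|C| K))) // mulrDr lerD2l.
    by rewrite ler_piMl ?a_le1 // divr_ge0 ?exprn_ge0.
  rewrite big_split /= -mulr_suml lerD2l -big_mkcond /= sumr_const.
  have Cn : (#|C| <= n)%N by rewrite -[n in (_ <= n)%N]card_ord max_card.
  have -> : #|(fun V : {set 'I_n} => C \subset V)| = (2 ^ (n - #|C|))%N.
    by rewrite -card_supersets; apply: eq_card => V; rewrite !inE.
  by rewrite -[_ *+ _]mulr_natl natrX mulrA -exprD subnK.
rewrite big_split /= -mulr_suml exchange_big /=.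
under eq_bigr => V _ do rewrite a1.
have cardP : #|{: {set 'I_n}}| = (2 ^ n)%N.
  by rewrite -cardsT -powersetT card_powerset cardsT card_ord.
rewrite !sumr_const cardP natrX -[K.+1%:R]natr1 mulrDr mulr1 lerD2l.
rewrite -[_ *+ _]mulr_natl mulrCA ler_piMr ?exprn_ge0 //.
by rewrite ler_pdivrMr ?exprn_gt0 // mul1r -natrX ler_nat.
Qed.

Lemma sum_add_elem (h : {set 'I_n} -> R) (x : 'I_n) :
  \sum_V h (x |: V) = (\sum_(V : {set 'I_n} | x \in V) h V) *+ 2.
Proof.
rewrite (bigID (fun V : {set 'I_n} => x \in V)) /= mulr2n; congr (_ + _).
  by apply: eq_bigr => V xV; rewrite (setUidPr _) // sub1set.
rewrite (reindex_onto (fun V => V :\ x) (fun V => x |: V)) /=; last first.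
  by move=> V xV; rewrite setU1K.
apply: eq_big => [V|V /andP[_ /eqP ->]] //.
  rewrite setD11 /=; apply/eqP/idP => [<-|xV]; last by rewrite setD1K.
  by rewrite setU11.
Qed.

Lemma certain_hit_le (b : 'I_n -> M -> R) :
  (forall x m, 0 <= b x m <= 1) ->
  (forall V x m, 0 < a V m -> 0 < b x m -> x \in V) ->
  \sum_(V : {set 'I_n}) \sum_x \sum_m a (x |: V) m * b x m <= (2 ^+ n * K.+1%:R) *+ 2.
Proof.
move=> b01 bV; rewrite exchange_big /=.
under eq_bigr => x _ do rewrite (sum_add_elem (fun V => \sum_m a V m * b x m)).
rewrite sumrMnl lerMn2r /=.
apply: le_trans certain_mass_le.
under eq_bigr => x _ do rewrite big_mkcond.
rewrite exchange_big /=; apply: ler_sum => V _.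
(* As [b] does not depend on [V], [b x m] is positive only if [x] is certain for [m]. *)
apply: (@le_trans _ _ (\sum_x \sum_m a V m * (x \in certain m)%:R)).
  apply: ler_sum => x _.
  apply: (@le_trans _ _ (\sum_m a V m * b x m)).
    case: ifP => // _; apply: sumr_ge0 => m _.
    by rewrite mulr_ge0 //; case/andP: (b01 x m).
  apply: ler_sum => m _; rewrite ler_wpM2l //.
  case/andP: (b01 x m); rewrite le_eqVlt => /predU1P[<- _|bx b1]; first exact: ler0n.
  suff -> : x \in certain m by [].
  by rewrite inE; apply/forallP => V'; apply/implyP => aV'; apply: bV aV' bx.
rewrite exchange_big /=; apply: ler_sum => m _.
rewrite -mulr_sumr ler_wpM2l // -natr_sum ler_nat -sum1_card [leqRHS]big_mkcond.
by apply: leq_sum => x _; case: ifP.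
Qed.

End Counting.

Lemma card_msg L : (#|msg L| <= 2 ^ L.+1)%N.
Proof.
rewrite card_tagged sumnE big_map big_enum /=.
under eq_bigr => i _ do rewrite card_tuple card_bool.
elim: L.+1 => [|k IHk]; first by rewrite big_ord0.
by rewrite big_ord_recr /= expnS mul2n -addnn leq_add2r.
Qed.

(** * Output laws of protocols *)

Section Protocol.
Variables (W : finType) (p L : nat) (P : protocol W p L) (k : nat) (part : W -> 'I_p).
Implicit Types (V : nat -> {set W}) (f : {set W} -> R).

(* The law of the output given the message m of player i, for c = p - 2 - i. *)
Fixpoint tail V f (c i : nat) (m : msg L) : {ffun {set W} -> R} :=
  match c with
  | 0 => pmf (last_player P k part (V (p - 1)%N) (oracle part f (p - 1)) m)
  | c'.+1 => [ffun S => \sum_(m' : msg L)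
      middle_player P i.+1 k part (V i.+1) (oracle part f i.+1) m m' * tail V f c' i.+1 m' S]
  end.

Lemma out_law_tail V f c i S : (i + c = p - 2)%N ->
  out_law P k part V f S = \sum_m msg_law P k part V f i m * tail V f c i m S.
Proof.
elim: c i => [|c IHc] i /= icp; first by rewrite addn0 in icp; rewrite ffunE icp.
rewrite (IHc i.+1) ?addSnnS //=.
under eq_bigr => m' _ do rewrite ffunE mulr_suml.
rewrite exchange_big /=; apply: eq_bigr => m _.
by rewrite ffunE mulr_sumr; apply: eq_bigr => m' _; rewrite mulrA.
Qed.

Lemma msg_law_ge0 V f i m : 0 <= msg_law P k part V f i m.
Proof.
elim: i m => [|i IHi] m /=; first exact: pmf_ge0.
by rewrite ffunE sumr_ge0 // => m' _; rewrite mulr_ge0 ?pmf_ge0.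
Qed.

Lemma msg_law_sum1 V f i : \sum_m msg_law P k part V f i m = 1.
Proof.
elim: i => [|i IHi] /=; first exact: pmf_sum1.
under eq_bigr => m _ do rewrite ffunE.
rewrite exchange_big /= -[RHS]IHi; apply: eq_bigr => m _.
by rewrite -mulr_sumr pmf_sum1 mulr1.
Qed.

Lemma tail_ge0 V f c i m S : 0 <= tail V f c i m S.
Proof.
elim: c i m => [|c IHc] i m /=; first exact: pmf_ge0.
by rewrite ffunE sumr_ge0 // => m' _; rewrite mulr_ge0 ?pmf_ge0.
Qed.

Lemma tail_sum1 V f c i m : \sum_S tail V f c i m S = 1.
Proof.
elim: c i m => [|c IHc] i m /=; first exact: pmf_sum1.
under eq_bigr => S _ do rewrite ffunE.
rewrite exchange_big /= -[RHS](pmf_sum1 (middle_player P i.+1 k part (V i.+1) (oracle part f i.+1) m)).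
by apply: eq_bigr => m' _; rewrite -mulr_sumr IHc mulr1.
Qed.

Lemma out_law_ge0 V f S : 0 <= out_law P k part V f S.
Proof. by rewrite ffunE sumr_ge0 // => m _; rewrite mulr_ge0 ?msg_law_ge0 ?pmf_ge0. Qed.

Lemma out_law_sum1 V f : \sum_S out_law P k part V f S = 1.
Proof.
under eq_bigr => S _ do rewrite (@out_law_tail V f 0 (p - 2)) ?addn0 //.
rewrite exchange_big /= -[RHS](msg_law_sum1 V f (p - 2)); apply: eq_bigr => m _.
by rewrite -mulr_sumr pmf_sum1 mulr1.
Qed.

Lemma msg_law_ext V V' f f' i :
  (forall j, (j <= i)%N -> V j = V' j) ->
  (forall j, (j <= i)%N -> oracle part f j = oracle part f' j) ->
  msg_law P k part V f i = msg_law P k part V' f' i.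
Proof.
elim: i => [|i IHi] eV ef /=; first by rewrite eV // ef.
rewrite IHi => [|j ji|j ji]; last 2 first.
- by rewrite eV // ltnW.
- by rewrite ef // ltnW.
by rewrite eV // ef.
Qed.

Lemma tail_ext V V' f f' c i m : (1 < p)%N -> (i + c = p - 2)%N ->
  (forall j, (i < j < p)%N -> V j = V' j) ->
  (forall j, (i < j < p)%N -> oracle part f j = oracle part f' j) ->
  tail V f c i m = tail V' f' c i m.
Proof.
move=> p1; elim: c i m => [|c IHc] i m /= icp eV ef.
  have ip : (i < p - 1 < p)%N.
    rewrite addn0 in icp; rewrite icp; case: p p1 => [|[|?]] // _.
    by rewrite !subSS !subn0 ltnSn /=.
  by rewrite eV // ef.
have ip : (i < i.+1 < p)%N.
  rewrite ltnSn /= -(subnK p1) -icp; lia.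
apply/ffunP => S; rewrite !ffunE; apply: eq_bigr => m' _.
rewrite eV // ef // IHc ?addSnnS // => j /andP[ij jp].
  by rewrite eV // jp ltnW.
by rewrite ef // jp ltnW.
Qed.

End Protocol.

(** * The hard instances *)

(** Blocks of [n] consecutive elements in an enumeration of [W] start the classes; [minn] puts all
    the rest into the last class, nonempty because [q * n < #|W|]. *)
Lemma partition_layout (W : finType) (q n : nat) : (0 < n)%N -> (q * n < #|W|)%N ->
  exists (part : W -> 'I_q.+1) (e : nat -> 'I_n -> W) (z : W),
    [/\ forall k x, (k < q)%N -> part (e k x) = k :> nat,
        forall k, (k < q)%N -> injective (e k)
      & part z = q :> nat].
Proof.
move=> n0 qnW; have /card_gt0P[w0 _] := leq_ltn_trans (leq0n _) qnW.
pose s := enum W; have us : uniq s := enum_uniq W.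
have ss : size s = #|W| by rewrite /s -cardE.
pose part w : 'I_q.+1 := inord (minn q (index w s %/ n)).
have partE i : (i < #|W|)%N -> part (nth w0 s i) = minn q (i %/ n) :> nat.
  by move=> iW; rewrite /part index_uniq ?ss // inordK // ltnS geq_minl.
have kx k (x : 'I_n) : (k < q)%N -> (k * n + x < #|W|)%N.
  move=> kq; apply: leq_trans (ltnW qnW).
  by apply: leq_trans (_ : k.+1 * n <= _)%N; rewrite ?leq_mul2r ?kq ?orbT // mulSn addnC ltn_add2r.
exists part, (fun k x => nth w0 s (k * n + x)), (nth w0 s (q * n)); split.
- move=> k x kq; rewrite partE ?kx // divnMDl // divn_small // addn0.
  by apply/minn_idPr; apply: ltnW.
- move=> k kq x y /eqP; rewrite nth_uniq ?ss ?kx // eqn_add2l => /eqP xy.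
  exact: val_inj.
- by rewrite partE // mulnK // minnn.
Qed.

(** Exchanging the new value [x] with the overwritten [F i] is an involution on pairs. *)
Lemma sum_finfun_update (A : zmodType) (I Q : finType) (i : I) (h : {ffun I -> Q} -> A) :
  \sum_(F : {ffun I -> Q}) \sum_x h [ffun k => if k == i then x else F k]
  = (\sum_F h F) *+ #|Q|.
Proof.
pose up (u : {ffun I -> Q} * Q) : {ffun I -> Q} * Q :=
  ([ffun k => if k == i then u.2 else u.1 k], u.1 i).
have upK : involutive up.
  case=> F x; rewrite /up /= ffunE eqxx; congr (_, _).
  by apply/ffunP => k; rewrite !ffunE; case: eqP => // ->.
transitivity (\sum_u h (up u).1); first by rewrite pair_big.
rewrite (reindex_inj (inv_inj upK)); under eq_bigr => u _ do rewrite upK.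
rewrite -(pair_big xpredT xpredT (fun (F : {ffun I -> Q}) (_ : Q) => h F)) /=.
by under eq_bigr => F _ do rewrite sumr_const; rewrite sumrMnl.
Qed.

Lemma approx_thresholdE p eps : approx_threshold p eps = threshold R p * (1 + eps).
Proof. by rewrite /approx_threshold /threshold RdivE. Qed.

(** * Random instances and their average hit probability *)

Section Instances.
Variables (W : finType) (r n L : nat) (P : protocol W r.+2 L) (part : W -> 'I_r.+2).
Variables (e : nat -> 'I_n -> W) (z : W).
Hypothesis part_e : forall k x, (k < r.+1)%N -> part (e k x) = k :> nat.
Hypothesis e_inj : forall k, (k < r.+1)%N -> injective (e k).
Hypothesis part_z : part z = r.+1 :> nat.
Local Notation data := {ffun 'I_r.+1 -> {set 'I_n} * 'I_n}.
Implicit Types F : data.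

(** [F] lists, for each player but the last, a set of indices and the index of the special element,
    which need not lie in that set; the last player holds only [z]. *)
Definition special F k : W := if (k < r.+1)%N then e k (F (inord k)).2 else z.
Definition private F k : {set W} :=
  if (k < r.+1)%N then e k @: (F (inord k)).1 else if k == r.+1 then [set z] else set0.
Definition value F : {set W} -> R := chain R part (special F).
Definition hit F i :=
  \sum_(S : {set W} | special F i \in S) out_law P r.+2 part (private F) (value F) S.

Lemma special_class_section F : class_section part (special F).
Proof.
move=> k; rewrite ltnS leq_eqVlt /special => /predU1P[->|kr]; first by rewrite ltnn.
by rewrite kr part_e.
Qed.

Lemma private_valid F : valid_private part (private F).
Proof.
move=> k; rewrite /private; case: ifP => kr.
  by apply/subsetP => w /imsetP[x _ ->]; rewrite inE part_e.
by case: eqP => [->|_]; rewrite ?sub0set // sub1set inE part_z.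
Qed.

Lemma mem_union_private F i y : (i < r.+1)%N ->
  e i y \in union_V r.+2 (private F) -> y \in (F (inord i)).1.
Proof.
move=> ir /bigcupP[k _ ek].
have := subsetP (private_valid F k) _ ek; rewrite inE part_e // => /eqP ik.
by move: ek; rewrite -ik /private ir mem_imset //; exact: e_inj.
Qed.

Lemma oracle_value F F' i : (i < r.+2)%N ->
  (forall k : 'I_r.+1, (k < i)%N -> (F k).2 = (F' k).2) ->
  oracle part (value F) i = oracle part (value F') i.
Proof.
move=> ir FF'; apply: functional_extensionality => S.
apply: chain_local => //; try exact: special_class_section.
by move=> k ki; rewrite /special; case: ifP => // kr; rewrite FF' // inordK.
Qed.

Definition upd F (i : 'I_r.+1) u : data := [ffun k => if k == i then u else F k].

Lemma private_upd F (i : 'I_r.+1) u u' k : (k != i :> nat) || (u.1 == u'.1) ->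
  private (upd F i u) k = private (upd F i u') k.
Proof.
move=> ki; rewrite /private; case: ifP => // kr; rewrite !ffunE; case: eqP => // kE.
by move: ki; rewrite -kE inordK // eqxx => /eqP ->.
Qed.

Hypothesis feasible : forall F S,
  0 < out_law P r.+2 part (private F) (value F) S -> S \subset union_V r.+2 (private F).

(** With the other classes fixed, the message of player [i] depends on [V] but not on [x], and the
    later players on [x] and the message but not on [V], as [certain_hit_le] requires; hence the
    dummy values [x0] in [a] and [set0] in [T]. *)
Lemma hit_sum_le F (i : 'I_r.+1) :
  \sum_(V : {set 'I_n}) \sum_x hit (upd F i (x |: V, x)) i <= (2 ^+ n * L.+2%:R) *+ 2.
Proof.
have ir := ltn_ord i; have iE : inord i = i by rewrite inord_val.
pose x0 := (F i).2.
pose a V := msg_law P r.+2 part (private (upd F i (V, x0))) (value (upd F i (V, x0))) i.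
pose T x m S := tail P r.+2 part (private (upd F i (set0, x)))
  (value (upd F i (set0, x))) (r - i) i m S.
have out V x S : out_law P r.+2 part (private (upd F i (V, x))) (value (upd F i (V, x))) S =
    \sum_m a V m * T x m S.
  rewrite (@out_law_tail _ _ _ _ _ _ _ _ (r - i) i); last by rewrite !subSS subn0 subnKC // -ltnS.
  apply: eq_bigr => m _; congr (_ * _).
    rewrite /a (@msg_law_ext _ _ _ _ _ _ _ (private (upd F i (V, x0))) _
      (value (upd F i (V, x0)))) // => j ji; first by apply: private_upd; rewrite eqxx orbT.
    apply: oracle_value => [|k' kj]; first by rewrite (leq_ltn_trans ji) // ltnW.
    by rewrite !ffunE; case: eqP kj => // ->; rewrite ltnNge ji.
  rewrite /T (@tail_ext _ _ _ _ _ _ _ (private (upd F i (set0, x))) _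
      (value (upd F i (set0, x)))) //.
  - by rewrite !subSS subn0 subnKC // -ltnS.
  - by move=> j /andP[ij _]; apply: private_upd; rewrite gtn_eqF.
  - move=> j /andP[_ jr]; apply: oracle_value => // k' _.
    by rewrite !ffunE; case: eqP.
pose b x m := \sum_(S : {set W} | e i x \in S) T x m S.
have sp V x : special (upd F i (V, x)) i = e i x.
  by rewrite /special ir iE ffunE eqxx.
apply: le_trans (@certain_hit_le R n L.+1 (msg L) a _ _ (card_msg L) b _ _).
- rewrite le_eqVlt; apply/orP; left; apply/eqP.
  apply: eq_bigr => V _; apply: eq_bigr => x _; rewrite /hit sp.
  under eq_bigr => S _ do rewrite out.
  by rewrite exchange_big /=; apply: eq_bigr => m _; rewrite mulr_sumr.
- by move=> V m; apply: msg_law_ge0.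
- by move=> V; apply: msg_law_sum1.
- move=> x m; have T0 S : 0 <= T x m S by apply: tail_ge0.
  rewrite sumr_ge0 //= -(tail_sum1 P r.+2 part (private (upd F i (set0, x)))
    (value (upd F i (set0, x))) (r - i) i m).
  by rewrite [leRHS](bigID (fun S : {set W} => e i x \in S)) /= lerDl sumr_ge0 // => S _; exact: tail_ge0.
(* Feasibility is applied to the instance with private set [V], which might lack [x]: outputting
   [e i x] there forces [x \in V]. *)
move=> V x m aV bx.
have [S xS TS] : exists2 S : {set W}, e i x \in S & 0 < T x m S.
  have /psumr_neq0P : b x m <> 0 by apply/eqP; rewrite gt_eqF.
  by case=> [S _|S /andP[xS TS]]; [exact: tail_ge0 | exists S].
have /feasible/subsetP/(_ _ xS) :
    0 < out_law P r.+2 part (private (upd F i (V, x))) (value (upd F i (V, x))) S.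
  rewrite out (bigD1 m) //= ltr_pwDl ?mulr_gt0 // sumr_ge0 // => m' _.
  by rewrite mulr_ge0 ?msg_law_ge0 ?tail_ge0.
by move/(mem_union_private ir); rewrite iE ffunE eqxx.
Qed.

(** Adding the special elements to the private sets makes the optimum, of value 1, available. *)
Definition norm F : data := [ffun k => ((F k).2 |: (F k).1, (F k).2)].

Lemma hit_total_le (i : 'I_r.+1) : (0 < n)%N ->
  \sum_F hit (norm F) i <= #|{: data}|%:R * (2 * L.+2%:R / n%:R).
Proof.
move=> n0; have n0R : 0 < n%:R :> R by rewrite ltr0n.
(* Resampling the pair of class [i] preserves the uniform average over [F] and brings in the double
   sum of [hit_sum_le]. *)
have := sum_finfun_update i (fun F => hit (norm F) i).
have -> : #|{: {set 'I_n} * 'I_n}| = (2 ^ n * n)%N.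
  by rewrite card_prod card_ord -cardsT -powersetT card_powerset cardsT card_ord.
rewrite -[_ *+ (_ * _)]mulr_natr natrM natrX => E.
have D0 : 0 < 2 ^+ n * n%:R :> R by rewrite mulr_gt0 ?exprn_gt0.
rewrite -(ler_pM2r D0) -E.
have -> : #|{: data}|%:R * (2 * L.+2%:R / n%:R) * (2 ^+ n * n%:R) =
    \sum_(F : data) (2 ^+ n * L.+2%:R) *+ 2 :> R.
  rewrite sumr_const -[_ *+ #|_|]mulr_natl -[_ *+ 2]mulr_natl.
  by field; rewrite gt_eqF.
apply: ler_sum => F _; apply: le_trans (hit_sum_le (norm F) i).
rewrite pair_big /= le_eqVlt; apply/orP; left; apply/eqP.
apply: eq_bigr => -[V x] _ /=; congr (hit _ _).
by apply/ffunP => k; rewrite !ffunE; case: eqP.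
Qed.

Variable eps : R.
Hypothesis approx : forall F (T : {set W}), T \subset union_V r.+2 (private F) -> (#|T| <= r.+2)%N ->
  threshold R r.+2 * (1 + eps) * value F T <=
  \sum_S out_law P r.+2 part (private F) (value F) S * value F S.
Hypothesis small : forall F S,
  0 < out_law P r.+2 part (private F) (value F) S -> (#|S| <= r.+2)%N.

Lemma hit_ge F : 0 <= eps -> eps / 2 <= \sum_(i < r.+1) hit (norm F) i.
Proof.
move=> eps0; set G := norm F.
have : threshold R r.+2 * (1 + eps) <= threshold R r.+2 + \sum_(i < r.+1) hit G i.
  pose T := [set special G k | k : 'I_r.+2].
  have := @approx G T.
  rewrite {1}/value chain_full ?mulr1 //; last first.
    by move=> k kr; apply/imsetP; exists (Ordinal kr).
  move=> /(_ _ _)/le_trans; apply.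
  - apply/subsetP => w /imsetP[k _ ->]; apply/bigcupP; exists k => //.
    rewrite /special /private; case: ifP => kr.
      by rewrite imset_f // !ffunE /= setU11.
    have -> : k == r.+1 :> nat by rewrite eqn_leq -ltnS ltn_ord leqNgt kr.
    by rewrite set11.
  - by rewrite (leq_trans (leq_imset_card _ _)) // card_ord.
  (* Pointwise, the value of [S] is at most the threshold plus the number of special elements hit
     before the last class: without any, [chain_avoid_le] applies; with one, the value is at most
     1. *)
  apply: (@le_trans _ _ (\sum_S out_law P r.+2 part (private G) (value G) S *
     (threshold R r.+2 + \sum_(i < r.+1) (special G i \in S)%:R))).
    apply: ler_sum => S _; have := out_law_ge0 P r.+2 part (private G) (value G) S.
    rewrite le_eqVlt => /predU1P[<-|oS]; first by rewrite !mul0r.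
    rewrite ler_pM2l //.
    have [/existsP[i iS]|/existsPn noS] := boolP [exists i : 'I_r.+1, special G i \in S].
      apply: (@le_trans _ _ 1); first exact: chain_le1.
      rewrite (bigD1 i) //= iS addrCA lerDl addr_ge0 ?sumr_ge0 //.
      by rewrite (le_trans _ (threshold_ge12 R _)) // divr_ge0.
    apply: (@le_trans _ _ (threshold R r.+2)); last first.
      by rewrite lerDl sumr_ge0 // => j _; rewrite ler0n.
    apply: le_trans (threshold_ge R (isT : 1 < r.+2)%N).
    apply: chain_avoid_le => //; first exact: small oS.
    by move=> k kr; apply: (noS (Ordinal kr)).
  under eq_bigr => S _ do rewrite mulrDr mulr_sumr.
  rewrite big_split /= -mulr_suml out_law_sum1 mul1r lerD2l exchange_big /=.
  apply: ler_sum => i _; rewrite /hit [leRHS]big_mkcond.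
  by apply: ler_sum => S _; case: ifP; rewrite ?mulr1 ?mulr0.
have := threshold_ge12 R (isT : 1 < r.+2)%N.
by set t := threshold _; set h := \sum_(_ < _) _; nra.
Qed.

Lemma eps_le : 0 <= eps -> (0 < n)%N -> eps * n%:R <= 4 * r.+1%:R * L.+2%:R.
Proof.
move=> eps0 n0; have n0R : 0 < n%:R :> R by rewrite ltr0n.
have D0 : 0 < #|{: data}|%:R :> R.
  by rewrite ltr0n; apply/card_gt0P; exists [ffun=> (set0, Ordinal n0)].
have : \sum_(F : data) eps / 2 <= \sum_(F : data) \sum_(i < r.+1) hit (norm F) i.
  by apply: ler_sum => F _; apply: hit_ge.
rewrite exchange_big /= => /le_trans/(_ (ler_sum _ (fun i _ => hit_total_le i n0))).
have -> : \sum_(F : data) eps / 2 = #|{: data}|%:R * (eps / 2).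
  by rewrite sumr_const mulr_natl.
rewrite sumr_const card_ord -[_ *+ r.+1]mulr_natl [X in _ <= X]mulrCA ler_pM2l //.
rewrite mulrA ler_pdivlMr //; set a := eps; set b := n%:R; set c := r.+1%:R; set d := L.+2%:R; lra.
Qed.

End Instances.

(** This serves to derive [eps <= 1] and to absorb [L + 2] into [3 L]. With [f] the indicator of
    [w \in S] and only the empty message, the last player cannot tell whether player 1 holds [w], so
    outputting [w] would be infeasible on some instance. *)
Lemma guarantee_nontrivial (W : finType) (p L : nat) (P : protocol W p L) (rho : R) :
  (1 < p)%N -> (0 < #|W|)%N -> 0 < rho -> guarantee_on_coverage_k_eq_p P rho ->
  rho <= 1 /\ (0 < L)%N.
Proof.
case: p P => [|p] // P p1 /card_gt0P[w _] rho0 gP.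
pose f : {set W} -> R := fun S => \sum_(j < 1) 1 * (1 - \prod_(v in S) (v != w)%:R).
have cf : weighted_coverage f.
  apply: (@weighted_coverage_mixture W 0 (fun=> 1) (fun _ v => (v != w)%:R)) => [_|_ v].
    exact: ler01.
  by case: (v != w); rewrite ?lexx ler01.
have fin (S : {set W}) : w \in S -> f S = 1.
  by move=> wS; rewrite /f big_ord1 (bigD1 w) //= eqxx mul0r subr0 mul1r.
have fout (S : {set W}) : w \notin S -> f S = 0.
  move=> wS; rewrite /f big_ord1 big1 ?subrr ?mulr0 // => v vS.
  by case: eqP vS wS => // -> ->.
pose part (_ : W) : 'I_p.+1 := ord0.
pose V i := if i == 0%N then [set w] else set0.
have vV : valid_private part V.
  by move=> [|i]; rewrite /V ?sub0set //; apply/subsetP => x _; rewrite inE.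
have [_ /(_ [set w])] := gP part V f vV cf.
rewrite cards1 fin ?set11 // mulr1 => /(_ _ isT) rho_le.
have {}rho_le : rho <= \sum_S out_law P p.+1 part V f S * f S.
  by apply: rho_le; apply/subsetP => x xw; apply/bigcupP; exists ord0.
have o0 S := out_law_ge0 P p.+1 part V f S.
have f01 S : 0 <= f S <= 1.
  by have [/fin ->|/fout ->] := boolP (w \in S); rewrite ?lexx ler01.
split.
  rewrite (le_trans rho_le) // -(out_law_sum1 P p.+1 part V f).
  by apply: ler_sum => S _; rewrite ler_piMr //; case/andP: (f01 S).
case: (posnP L) => // L0.
have [S wS oS] : exists2 S : {set W}, w \in S & 0 < out_law P p.+1 part V f S.
  have /psumr_neq0P[S _|S /= oS] : \sum_S out_law P p.+1 part V f S * f S <> 0.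
  - by apply/eqP; rewrite gt_eqF // (lt_le_trans rho0).
  - by rewrite mulr_ge0 //; case/andP: (f01 S).
  have wS : w \in S by apply: contraTT oS => /fout ->; rewrite mulr0 ltxx.
  by exists S => //; rewrite fin // mulr1 in oS.
pose V' (_ : nat) : {set W} := set0.
have vV' : valid_private part V' by move=> i; rewrite sub0set.
have card1 : (#|msg L| <= 1)%N.
  rewrite L0 card_tagged sumnE big_map big_enum /= big_ord1 card_tuple card_bool //.
have law1 U m : msg_law P p.+1 part U f 0 m = 1.
  rewrite -(msg_law_sum1 P p.+1 part U f 0) (bigD1 m) //= big1 ?addr0 // => m' m'm.
  by move/card_le1_eqP: card1 => /(_ m' m isT isT) E; rewrite E eqxx in m'm.
have out_eq : out_law P p.+1 part V f S = out_law P p.+1 part V' f S.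
  have p2 : (0 + (p.+1 - 2) = p.+1 - 2)%N by [].
  rewrite !(@out_law_tail _ _ _ _ _ _ _ _ (p.+1 - 2) 0) //; apply: eq_bigr => m _.
  rewrite !law1 (@tail_ext _ _ _ _ _ _ _ V' _ f) // => -[|j] //.
have [/(_ S) + _] := gP part V' f vV' cf.
rewrite -out_eq => /(_ oS)[/subsetP/(_ _ wS)/bigcupP[i _]].
by rewrite inE.
Qed.

Theorem theorem3 :
  exists c : R, 0 < c /\
  forall (eps : R) (p : nat), 0 < eps -> (2 <= p)%N ->
  forall (W : finType) (L : nat) (P : protocol W p L),
    guarantee_on_coverage_k_eq_p P (approx_threshold p eps) ->
    c * (#|W|%:R * eps / (p ^ 3)%:R) <= L%:R.
Proof.
(* With [q = p - 1], the bounds [N <= 2 q n], [eps n <= 4 q (L + 2)] and [L + 2 <= 3 L] give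
   [N eps <= 24 q^2 L], and [q^2 <= p^3]. *)
exists 24%:R^-1; split; first by rewrite invr_gt0 ltr0n.
move=> eps p eps0 p1 W L P; rewrite approx_thresholdE => gP.
have t12 := threshold_ge12 R p1.
have [->|W0] := posnP #|W|; first by rewrite !mul0r mulr0 ler0n.
have rho0 : 0 < threshold R p * (1 + eps) by nra.
have [rho1 L0] := guarantee_nontrivial p1 W0 rho0 gP.
have eps1 : eps <= 1 by nra.
case: p p1 P gP {t12 rho0 rho1} => [|[|r]] // _ P gP.
have p0 : 0 < (r.+2 ^ 3)%:R :> R by rewrite ltr0n expn_gt0.
suff Neps : #|W|%:R * eps <= 24%:R * (r.+2 ^ 3)%:R * L%:R.
  rewrite mulrC ler_pdivrMr ?ltr0n // ler_pdivrMr //.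
  by rewrite -mulrA [leRHS]mulrC.
(* The largest block length for which [p - 1] blocks leave an element for the last class. *)
pose n := (#|W|.-1 %/ r.+1)%N.
have L0R : 1 <= L%:R :> R by rewrite ler1n.
(* Without room for blocks, [N < p], and [eps <= 1 <= L] settles the claim. *)
have [n0|n0] := posnP n.
  have Wr : (#|W| <= r.+1)%N.
    move/eqP: n0; rewrite /n -leqn0 leqNgt divn_gt0 // -ltnNge => Wr.
    by rewrite -(prednK W0).
  have Wp : #|W|%:R <= (r.+2 ^ 3)%:R :> R.
    by rewrite ler_nat (leq_trans Wr) // (leq_trans (leqnSn _)) // -[leqLHS]expn1 leq_exp2l.
  have W0R : 0 <= #|W|%:R :> R by rewrite ler0n.
  by nra.
have qnW : (r.+1 * n < #|W|)%N.
  by rewrite mulnC (leq_ltn_trans (leq_divM _ _)) // ltn_predL.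
have [part [e [z [part_e e_inj part_z]]]] := partition_layout n0 qnW.
have vF F := private_valid part_e part_z F.
have cF F : weighted_coverage (value part e z F) by apply: chain_coverage.
have := @eps_le W r n L P part e z part_e e_inj part_z
  (fun F S oS => proj1 (proj1 (gP part _ _ (vF F) (cF F)) S oS)) eps
  (fun F T => proj2 (gP part _ _ (vF F) (cF F)) T)
  (fun F S oS => proj2 (proj1 (gP part _ _ (vF F) (cF F)) S oS)) (ltW eps0) n0.
have L2 : L.+2%:R <= 3 * L%:R :> R by rewrite -natrM ler_nat; lia.
have WN : #|W|%:R <= 2 * r.+1%:R * n%:R :> R.
  rewrite -!natrM ler_nat; have := ltn_ceil #|W|.-1 (ltn0Sn r).
  rewrite -/n prednK // => /leq_trans; apply.
  by rewrite mulnAC leq_mul2r mul2n -addnn -[n in (n < _)%N]add0n ltn_add2r n0 orbT.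
have r3 : r.+1%:R * r.+1%:R <= (r.+2 ^ 3)%:R :> R by rewrite -natrM ler_nat; nia.
have r0 : 0 <= r.+1%:R :> R by rewrite ler0n.
set q := r.+1%:R in WN r3 r0 *; set l := L%:R in L0R L2 *; set d := n%:R in WN *.
move=> epsn.
have h1 : #|W|%:R * eps <= 2 * q * (eps * d) by rewrite [eps * d]mulrC mulrA ler_pM2r.
have h2 : 2 * q * (eps * d) <= 2 * q * (4 * q * (3 * l)).
  by apply: ler_wpM2l; [lra|apply: le_trans epsn _; apply: ler_wpM2l => //; lra].
have h3 : q * q * l <= (r.+2 ^ 3)%:R * l by apply: ler_wpM2r => //; lra.
by lra.
Qed.
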